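(* Let $\mathsf a=(\mathsf a_{\ell,\ell'})_{\ell,\ell'\ge0}$, $\mathsf b=(\mathsf b_{\ell,\ell'})_{\ell,\ell'\ge0}$, $\mathsf c=(\mathsf c_{\ell,\ell'})_{\ell,\ell'\ge0}$, $\mathsf d=(\mathsf d_{\ell,\ell'})_{\ell,\ell'\ge0}$, $\mathsf e=(\mathsf e_\ell)_{\ell\ge0}$ be indeterminates, and for $n\ge0$ define $$\begin{aligned}Q_n(\mathsf a,\mathsf b,\mathsf c,\mathsf d,\mathsf e)=\sum_{\sigma\in\mathfrak S_n}\;&\prod_{i\in\mathrm{cval}}\mathsf a_{\mathrm{ucross}(i,\sigma),\,\mathrm{unest}(i,\sigma)}\prod_{i\in\mathrm{cpeak}}\mathsf b_{\mathrm{lcross}(i,\sigma),\,\mathrm{lnest}(i,\sigma)}\\&\times\prod_{i\in\mathrm{cdfall}}\mathsf c_{\mathrm{lcross}(i,\sigma),\,\mathrm{lnest}(i,\sigma)}\prod_{i\in\mathrm{cdrise}}\mathsf d_{\mathrm{ucross}(i,\sigma),\,\mathrm{unest}(i,\sigma)}\prod_{i\in\mathrm{fix}}\mathsf e_{\mathrm{lev}(i,\sigma)}.\end{aligned}$$ Write $\mathsf a^\star_{n-1}=\sum_{\ell=0}^{n-1}\mathsf a_{\ell,n-1-\ell}$ for $n\ge0$ (so $\mathsf a^\star_{-1}=0$), and likewise for $\mathsf b,\mathsf c,\mathsf d$. In the ring $\mathbb Z[\mathsf a,\mathsf b,\mathsf c,\mathsf d,\mathsf e]$, let $\mathcal I$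 be the ideal generated by the relations $$\mathsf c^\star_{n-1}+\mathsf d^\star_{n-1}+\mathsf e_n=\mathsf a^\star_{n-1}+\mathsf b^\star_n\qquad\text{for all } n\ge0 .$$ Then $$\sum_{n=0}^\infty Q_n(\mathsf a,\mathsf b,\mathsf c,\mathsf d,\mathsf e)\,t^n=\cfrac{1}{1-\cfrac{\alpha_1t}{1-\cfrac{\alpha_2t}{1-\cfrac{\alpha_3 t}{1-\cdots}}}}$$ with coefficients $\alpha_{2k-1}=\mathsf b^\star_{k-1}$ and $\alpha_{2k}=\mathsf a^\star_{k-1}$ ($k\ge1$), as an identity of formal power series in $t$ with coefficients in $\mathbb Z[\mathsf a,\mathsf b,\mathsf c,\mathsf d,\mathsf e]/\mathcal I$.
   Context: $\mathfrak S_n$ is the set of permutations of $[n]=\{1,\dots,n\}$. For $\sigma\in\mathfrak S_n$, an index $i\in[n]$ is a cycle peak (cpeak) if $\sigma^{-1}(i)<i>\sigma(i)$; a cycle valley (cval) if $\sigma^{-1}(i)>i<\sigma(i)$; a cycle double rise (cdrise) if $\sigma^{-1}(i)<i<\sigma(i)$; a cycle double fall (cdfall) if $\sigma^{-1}(i)>i>\sigma(i)$; a fixed point (fix) if $\sigma(i)=i$. Products over $i\in\mathrm{cval}$ etc. run over the indices of $\sigma$ of that type. Index-refined statistics (quadruplets and triplets in $[n]$): $\mathrm{ucross}(j,\sigma)=\#\{i<j<k<l:\ k=\sigma(i),\ l=\sigma(j)\}$, $\mathrm{unest}(j,\sigma)=\#\{i<j<k<l:\ k=\sigma(j),\ l=\sigma(i)\}$,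 $\mathrm{lcross}(k,\sigma)=\#\{i<j<k<l:\ i=\sigma(k),\ j=\sigma(l)\}$, $\mathrm{lnest}(k,\sigma)=\#\{i<j<k<l:\ i=\sigma(l),\ j=\sigma(k)\}$ (in the first two the index $j$ is fixed and one counts triples $(i,k,l)$; in the last two $k$ is fixed and one counts triples $(i,j,l)$). For a fixed point $j$, $\mathrm{lev}(j,\sigma)=\#\{i<j:\sigma(i)>j\}=\#\{l>j:\sigma(l)<j\}$. *)

(* Defs.v *)
From HB Require Import structures.
From mathcomp Require Import all_boot all_order all_fingroup all_algebra.
From mathcomp Require Import generic_quotient ring_quotient boolp.
From mathcomp.multinomials Require Import monalg.

Set Implicit Arguments.
Unset Strict Implicit.
Unset Printing Implicit Defensive.

Import GRing.Theory.
Local Open Scope ring_scope.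

Section PermStatistics.
Local Open Scope nat_scope.
(* [n] is represented by 'I_n = {0, .., n-1}; every notion below depends only
   on the order of the indices, so the shift by one is immaterial. *)
Variables (n : nat) (s : 'S_n).
Implicit Types i j k l : 'I_n.

Definition cpeak i := (s^-1%g i < i) && (s i < i).
Definition cval i := (i < s^-1%g i) && (i < s i).
Definition cdrise i := s^-1%g i < i < s i.
Definition cdfall i := s i < i < s^-1%g i.
Definition fixpt i := s i == i.

Definition ucross j := #|[set t : 'I_n * 'I_n * 'I_n | let: (i, k, l) := t in
  [&& i < j, j < k, k < l, k == s i & l == s j]]|.
Definition unest j := #|[set t : 'I_n * 'I_n * 'I_n | let: (i, k, l) := t in
  [&& i < j, j < k, k < l, k == s j & l == s i]]|.
Definition lcross k := #|[set t : 'I_n * 'I_n * 'I_n | let: (i, j, l) := t in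
  [&& i < j, j < k, k < l, i == s k & j == s l]]|.
Definition lnest k := #|[set t : 'I_n * 'I_n * 'I_n | let: (i, j, l) := t in
  [&& i < j, j < k, k < l, i == s l & j == s k]]|.
Definition lev j := #|[set i : 'I_n | (i < j) && (j < s i)]|.
End PermStatistics.

Definition Qpoly (R : comNzRingType) (a b c d : nat -> nat -> R) (e : nat -> R)
    (n : nat) : R :=
  \sum_(s : 'S_n)
    (\prod_(i | cval s i) a (ucross s i) (unest s i)) *
    (\prod_(i | cpeak s i) b (lcross s i) (lnest s i)) *
    (\prod_(i | cdfall s i) c (lcross s i) (lnest s i)) *
    (\prod_(i | cdrise s i) d (ucross s i) (unest s i)) *
    (\prod_(i | fixpt s i) e (lev s i)).

(* [pstar f n] is f^*_{n-1} = \sum_{l=0}^{n-1} f_{l,n-1-l}: the index is shifted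
   by one so that f^*_{-1} = 0 is [pstar f 0] and f^*_n is [pstar f n.+1]. *)
Definition pstar (R : nmodType) (f : nat -> nat -> R) (n : nat) : R :=
  \sum_(l < n) f l (n.-1 - l)%N.

Inductive indet :=
  | Ia of nat & nat | Ib of nat & nat | Ic of nat & nat | Id of nat & nat
  | Ie of nat.

Definition indet_code (v : indet) : nat * (nat * nat) :=
  match v with
  | Ia l m => (0, (l, m)) | Ib l m => (1, (l, m)) | Ic l m => (2, (l, m))
  | Id l m => (3, (l, m)) | Ie l => (4, (l, 0))
  end%N.
Definition indet_decode (x : nat * (nat * nat)) : indet :=
  let: (t, (l, m)) := x in
  match t with
  | 0 => Ia l m | 1 => Ib l m | 2 => Ic l m | 3 => Id l m | _ => Ie l
  end%N.
Lemma indet_codeK : cancel indet_code indet_decode.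
Proof. by case. Qed.
HB.instance Definition _ := Choice.copy indet (can_type indet_codeK).

(* Z[a, b, c, d, e]: the monoid algebra over int of the commutative monomials
   in the (infinitely many) indeterminates. *)
Notation Zabcde := {malg int[{cmonom indet}]}.

Definition X (v : indet) : Zabcde := << ucm v >>.
Definition Xa l m := X (Ia l m).
Definition Xb l m := X (Ib l m).
Definition Xc l m := X (Ic l m).
Definition Xd l m := X (Id l m).
Definition Xe l := X (Ie l).

(* The relation c*_{n-1} + d*_{n-1} + e_n = a*_{n-1} + b*_n, as an element of
   the polynomial ring. *)
Definition relator (n : nat) : Zabcde :=
  (pstar Xc n + pstar Xd n + Xe n) - (pstar Xa n + pstar Xb n.+1).

Definition relideal : {pred Zabcde} := fun p =>
  `[< exists N (u : 'I_N -> Zabcde), p = \sum_(n < N) u n * relator n >].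

Local Notation mcoeff1g := (mcoeff (mone : {cmonom indet})).

Lemma mcoeff1_X v : mcoeff1g (X v) = 0.
Proof. by rewrite /X mcoeffU1 cm1_eq1. Qed.

Lemma raddf_pstar (R S : zmodType) (phi : {additive R -> S}) f n :
  phi (pstar f n) = pstar (fun l m => phi (f l m)) n.
Proof. exact: raddf_sum. Qed.

Lemma raddf_rel (R S : zmodType) (phi : {additive R -> S}) x y z t u :
  phi ((x + y + z) - (t + u)) = (phi x + phi y + phi z) - (phi t + phi u).
Proof. by rewrite raddfB !raddfD. Qed.

Lemma mcoeff1_relator n : mcoeff1g (relator n) = 0.
Proof.
have star0 k I : mcoeff1g (pstar (fun l m => X (I l m)) k) = 0.
  by rewrite raddf_pstar /pstar big1 // => l _; apply: mcoeff1_X.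
have e0 := mcoeff1_X (Ie n).
have sum0 (x y z t u : int) : x = 0 -> y = 0 -> z = 0 -> t = 0 -> u = 0 ->
  (x + y + z) - (t + u) = 0 by do 5 move=> ->.
by apply: etrans (raddf_rel _ _ _ _ _ _) (sum0 _ _ _ _ _ (star0 _ Ic) (star0 _ Id)
  e0 (star0 _ Ia) (star0 _ Ib)).
Qed.

Lemma mcoeff1gM (p q : Zabcde) : mcoeff1g (p * q) = mcoeff1g p * mcoeff1g q.
Proof.
exact: (rmorphM (mcoeff (mone : {cmonom indet}) : {rmorphism Zabcde -> int})).
Qed.

Lemma relidealP p : reflect
  (exists N (u : 'I_N -> Zabcde), p = \sum_(n < N) u n * relator n)
  (p \in relideal).
Proof. exact: asboolP. Qed.

Lemma relideal_seq p : (p \in relideal) <->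
  exists N (u : nat -> Zabcde), p = \sum_(n < N) u n * relator n /\
    forall n, (N <= n)%N -> u n = 0.
Proof.
split=> [/relidealP[N [u ->]]|[N [u [-> _]]]]; last first.
  by apply/relidealP; exists N, (fun i : 'I_N => u i).
exists N, (fun i => if insub i is Some j then u j else 0); split.
  by apply: eq_bigr => i _; rewrite valK.
by move=> n lNn; rewrite insubF // ltnNge lNn.
Qed.

Lemma relideal_idealr_closed : idealr_closed relideal.
Proof.
split.
- by apply/relidealP; exists 0%N, (fun=> 0); rewrite big_ord0.
- apply/relidealP => -[N [u /(congr1 mcoeff1g)]].
  rewrite mcoeff1 eqxx raddf_sum big1 => [/eqP|i _]; first by rewrite oner_eq0.
  by apply: etrans (mcoeff1gM _ _) _; rewrite mcoeff1_relator mulr0.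
move=> r p q /relideal_seq[N [u [-> u0]]] /relideal_seq[M [v [-> v0]]].
apply/relideal_seq; exists (maxn N M), (fun n => r * u n + v n); split; last first.
  move=> n; rewrite geq_max => /andP[lN lM].
  by rewrite u0 // v0 // mulr0 addr0.
have widen (w : nat -> Zabcde) K : (K <= maxn N M)%N ->
    (forall n, (K <= n)%N -> w n = 0) ->
    \sum_(n < K) w n * relator n = \sum_(n < maxn N M) w n * relator n.
  move=> leK w0; rewrite (big_ord_widen _ (fun n => w n * relator n) leK).
  rewrite big_mkcond; apply: eq_bigr => i _; case: ifPn => //.
  by rewrite -leqNgt => /w0->; rewrite mul0r.
rewrite (widen u) ?leq_maxl // (widen v) ?leq_maxr // mulr_sumr -big_split.
by apply: eq_bigr => i _; rewrite mulrDl mulrA.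
Qed.
HB.instance Definition _ := isIdealr.Build Zabcde relideal relideal_idealr_closed.

Notation Zquot := {ideal_quot relideal}.
Definition proj (p : Zabcde) : Zquot := (\pi_Zquot p)%qT.

Lemma proj_eqP p q : reflect (proj p = proj q) (p - q \in relideal).
Proof. by rewrite Quotient.idealrBE; apply: eqP. Qed.

Definition fps (R : Type) := nat -> R.

Section FormalPowerSeries.
Variable R : comNzRingType.
Implicit Types f g : fps R.

Definition fps_one : fps R := fun n => (n == 0%N)%:R.
Definition fps_sub f g : fps R := fun n => f n - g n.
Definition fps_mul f g : fps R := fun n => \sum_(i < n.+1) f i * g (n - i)%N.
(* the monomial c t *)
Definition fps_ct (c : R) : fps R := fun n => c *+ (n == 1%N).

(* First n coefficients of 1/f when f has constant coefficient 1. *)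
Fixpoint fps_inv_seq f n : seq R :=
  if n isn't m.+1 then [::] else
  let r := fps_inv_seq f m in
  rcons r ((m == 0%N)%:R - \sum_(i < m) f i.+1 * r`_(m - i.+1)).
Definition fps_inv f : fps R := fun n => (fps_inv_seq f n.+1)`_n.

Lemma size_fps_inv_seq f n : size (fps_inv_seq f n) = n.
Proof. by elim: n => //= n IH; rewrite size_rcons IH. Qed.

Lemma nth_fps_inv_seq f n i : (i < n)%N -> (fps_inv_seq f n)`_i = fps_inv f i.
Proof.
elim: n => // n IH; rewrite ltnS leq_eqVlt => /orP[/eqP-> //|lin].
by rewrite /= nth_rcons size_fps_inv_seq lin IH.
Qed.

Lemma fps_mulV f : f 0%N = 1 -> fps_mul f (fps_inv f) =1 fps_one.
Proof.
move=> f0 n; rewrite /fps_mul big_ord_recl f0 mul1r subn0.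
rewrite {1}/fps_inv /= nth_rcons size_fps_inv_seq ltnn eqxx.
rewrite -[RHS]addr0 -addrA; congr (_ + _); apply/eqP.
rewrite addrC subr_eq0; apply/eqP; apply: eq_bigr => i _.
by rewrite nth_fps_inv_seq // /bump subnSK // leq_subr.
Qed.

(* Coefficientwise eventually constant, i.e. convergence in R[[t]]. *)
Definition fps_cvg (u : nat -> fps R) f :=
  forall n, exists N, forall m, (N <= m)%N -> u m n = f n.

(* 1/(1 - alpha_i t/(1 - alpha_{i+1} t/( ... 1/(1 - alpha_{i+m-1} t)))) *)
Fixpoint sfrac_tail (alpha : nat -> R) (m i : nat) : fps R :=
  if m isn't m'.+1 then fps_one else
  fps_inv (fps_sub fps_one
            (fps_mul (fps_ct (alpha i)) (sfrac_tail alpha m' i.+1))).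

(* The infinite continued fraction with coefficients alpha_1, alpha_2, ...
   ([alpha 0] is not used) is the limit of its finite truncations. *)
Definition is_sfrac (alpha : nat -> R) f :=
  fps_cvg (fun m => sfrac_tail alpha m 1) f.

End FormalPowerSeries.

(* Main.v *)
Require Import Defs.
From mathcomp Require Import all_boot all_order all_fingroup all_algebra.
From mathcomp Require Import generic_quotient ring_quotient boolp.
From mathcomp.multinomials Require Import monalg.
From mathcomp Require Import zify ring.

Set Implicit Arguments.
Unset Strict Implicit.
Unset Printing Implicit Defensive.
Import GRing.Theory.
Local Open Scope ring_scope.

(** The polynomial Q_n is first evaluated as a sum over weighted Motzkin paths,
    over any commutative ring ([Qpoly_motzkin]).

    Draw an arc from every source i to its value s i and read the positions
    m = 0, 1, ..., n - 1 from left to right. Just before m is read, h sources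
    below m are open (their value is at least m) and equally many values below m
    are vacant (their preimage is at least m). Two facts turn the refined
    crossing and nesting numbers into local data.
    - If m < s m, then the sources i < m that cross (resp. nest) with m are the
      open ones with s i < s m (resp. s i > s m). Hence, if the open sources are
      kept ordered by their values, to choose the pair (ucross, unest) of m is to
      choose the place of m in this order: it runs over the pairs (l, h' - l),
      where h' counts the other sources still open after m. When m is later
      reached as a value of an open source, that source must be the first one,
      so there is nothing left to choose.
    - If s m < m, then m picks its value among the vacant ones, and (lcross,
      lnest) counts the vacant values above and below it.
    All choices are independent of each other, so a cycle valley read at height h
    contributes the factor a*_h, a cycle double rise d*_(h-1), a cycle double fall
    c*_(h-1), a fixed point e_h and a cycle peak b*_(h-1): these are the step
    weights of a Motzkin path. Formally, [sum_compat] sums the weights of the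
    unread positions over all permutations that agree with the past, by downward
    induction on m, each step being cut into a half for the value m
    ([sum_close]) and a half for the source m ([sum_up], [sum_down],
    [sum_fixed]).

    The relations say that the level weight at height h is
    alpha_(2h) + alpha_(2h+1) (where alpha_0 stands for 0), while the down weight
    from h + 1 is alpha_(2h+1) and the up weight from h is alpha_(2h+2). Grouping the steps of a Dyck path in
    pairs gives exactly such Motzkin paths ([motzkin_dyck]), and the generating
    function of Dyck paths with weight alpha_i on each descent from height i is
    the S-fraction with coefficients alpha ([dyck_sfrac]): a path from height h
    to 0 factors at its first visits of heights h - 1, ..., 1, 0. Finally both
    Q_n and the relations are transported along the projection onto the quotient
    ring. *)

(** * Ranks in sequences of natural numbers *)

Section Seqs.
Local Open Scope nat_scope.

Lemma sum_ranks (R : nmodType) (g : nat -> nat -> R) (V : seq nat) : uniq V ->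
  (\sum_(v <- V) g (count (fun u => v < u)%N V) (count (fun u => u < v)%N V))%R =
  pstar g (size V).
Proof.
(* Both sides depend only on the set of entries, so the entries may be taken in
   decreasing order; the l-th of them then has l entries above it. *)
pose W := sort geq V; have pVW : perm_eq V W by rewrite perm_sym perm_sort.
move=> uV; have sW : sorted gtn W.
  have ->: sorted gtn W = uniq W && sorted geq W.
    have := ltn_sorted_uniq_leq (rev W); rewrite !rev_sorted rev_uniq => <-.
    by [].
  rewrite -(perm_uniq pVW) uV sort_sorted // => x y; exact: leq_total.
rewrite (perm_big _ pVW) (perm_size pVW) /=.
under eq_bigr => v _ do rewrite !(seq.permP pVW).
elim: {V uV pVW}W g sW => [|x W IH] g sW; first by rewrite /pstar big_nil big_ord0.
have xW : all (fun u => u < x) W by rewrite (order_path_min _ sW) // => a b c ? /ltn_trans; apply.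
have sW' := path_sorted sW.
rewrite big_cons /pstar /= big_ord_recl subn0 !ltnn /= !add0n; congr (g _ _ + _)%R.
- by apply/eqP; rewrite -leqn0 leqNgt -has_count; apply/hasPn => u /(allP xW); rewrite -leqNgt => /ltnW.
- by apply/eqP; rewrite -all_count.
transitivity (\sum_(v <- W) g (count (fun u => v < u)%N W).+1 (count (fun u => u < v)%N W))%R.
  rewrite big_seq [RHS]big_seq; apply: eq_bigr => v vW.
  by have vx := allP xW v vW; rewrite vx ltnNge (ltnW vx).
rewrite (IH (fun l => g l.+1)) // /pstar; apply: eq_bigr => l _.
by congr (g _ _); case: (size W) l => [[]|k l] //=; rewrite /bump; lia.
Qed.

(** The place of [x] in a sorted list is forced by the number of entries below
    [x]; this makes the rank of a new open source a free choice. *)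
Lemma sorted_ins (L : seq nat) x l : l <= size L -> x \notin L -> sorted ltn L ->
  sorted ltn (take l L ++ x :: drop l L) = (count (fun y => y < x) L == l).
Proof.
elim: L l => [|y L IH] [|l] //=.
  move=> _ nx sL; rewrite inE negb_or in nx; case/andP: nx => nxy nxL.
  have yL : all (fun u => y < u) L by exact: order_path_min ltn_trans sL.
  rewrite /= sL andbT; case: ltngtP nxy => // xy _.
  rewrite add0n -leqn0 leqNgt -has_count; symmetry.
  by apply/hasPn => u /(allP yL); lia.
rewrite ltnS => lL nx sL; rewrite inE negb_or in nx; case/andP: nx => nxy nxL.
have yL : all (fun u => y < u) L by exact: order_path_min ltn_trans sL.
have sL' := path_sorted sL.
rewrite path_sortedE; last exact: ltn_trans.
rewrite IH // all_cat /= andbCA -all_cat cat_take_drop yL andbT.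
case: ltngtP nxy => //= xy _.
have -> // : count (fun z => z < x) L = 0.
apply/eqP; rewrite -leqn0 leqNgt -has_count; apply/hasPn => u /(allP yL); lia.
Qed.
End Seqs.

(** * Weighted Motzkin paths *)

Section Motzkin.
Variable R : comNzRingType.

(** Total weight of the paths of length [k] from height [h] to height 0. *)
Fixpoint motzkin (up level down : nat -> R) (k h : nat) : R :=
  if k isn't k'.+1 then (h == 0%N)%:R else
  up h * motzkin up level down k' h.+1 + level h * motzkin up level down k' h +
  (if h is h'.+1 then down h' * motzkin up level down k' h' else 0).

End Motzkin.

(** * Scanning a permutation from left to right *)

Section Scan.
Variable n : nat.
Implicit Types (s : 'S_n) (m l : nat) (i j k u v o mo : 'I_n).
Implicit Types (A : seq ('I_n * 'I_n)) (O V L : seq 'I_n).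

Section Statistics.
Local Open Scope nat_scope.

(** In each of the four statistics two members of the quadruple are images of the
    other two, so a single index remains to be counted: the second source for the
    upper statistics, the second value for the lower ones. *)
Lemma ucrossE s j :
  ucross s j = #|[set i : 'I_n | (i < j) && (j < s i < s j)]|.
Proof.
rewrite -(card_imset _ (_ : injective (fun i => (i, s i, s j)))); last by move=> x y [].
apply: eq_card => -[[i k] l]; rewrite !inE; apply/idP/imsetP => [|[x] + [-> -> ->]].
  case/and5P=> ij jk kl /eqP ek /eqP el; subst k l.
  by exists i; rewrite ?inE ?ij ?jk.
by rewrite inE !eqxx !andbT.
Qed.

Lemma unestE s j :
  unest s j = #|[set i : 'I_n | (i < j) && (j < s j < s i)]|.
Proof.
rewrite -(card_imset _ (_ : injective (fun i => (i, s j, s i)))); last by move=> x y [].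
apply: eq_card => -[[i k] l]; rewrite !inE; apply/idP/imsetP => [|[x] + [-> -> ->]].
  case/and5P=> ij jk kl /eqP ek /eqP el; subst k l.
  by exists i; rewrite ?inE ?ij ?jk.
by rewrite inE !eqxx !andbT.
Qed.

Lemma lcrossE s k :
  lcross s k = #|[set u : 'I_n | (s k < u < k) && (k < (s^-1)%g u)]|.
Proof.
rewrite -(card_imset _ (_ : injective (fun u => (s k, u, (s^-1)%g u)))); last by move=> x y [].
apply: eq_card => -[[i j] l]; rewrite !inE; apply/idP/imsetP => [|[x] + [-> -> ->]].
  case/and5P=> ij jk kl /eqP ei /eqP ej; subst i j.
  by exists (s l); rewrite ?inE permK ?ij ?jk.
by rewrite inE permKV !eqxx !andbT -andbA.
Qed.

Lemma lnestE s k :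
  lnest s k = #|[set u : 'I_n | (u < s k < k) && (k < (s^-1)%g u)]|.
Proof.
rewrite -(card_imset _ (_ : injective (fun u => (u, s k, (s^-1)%g u)))); last by move=> x y [].
apply: eq_card => -[[i j] l]; rewrite !inE; apply/idP/imsetP => [|[x] + [-> -> ->]].
  case/and5P=> ij jk kl /eqP ei /eqP ej; subst i j.
  by exists (s l); rewrite ?inE permK ?ij ?jk.
by rewrite inE permKV !eqxx !andbT -andbA.
Qed.

Lemma card_count L (P : pred 'I_n) : uniq L -> #|[set x in L | P x]| = count P L.
Proof.
move=> uL; rewrite -size_filter -(card_uniqP (filter_uniq P uL)).
by apply: eq_card => x; rewrite !inE mem_filter andbC.
Qed.
End Statistics.

Definition below m : seq 'I_n := [seq i : 'I_n <- enum 'I_n | (i < m)%N].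

Lemma mem_below m i : (i \in below m) = (i < m)%N.
Proof. by rewrite mem_filter mem_enum andbT. Qed.

Lemma below_uniq m : uniq (below m).
Proof. by rewrite filter_uniq ?enum_uniq. Qed.

Lemma perm_belowS mo : perm_eq (below mo.+1) (mo :: below mo).
Proof.
apply: uniq_perm; rewrite /= ?below_uniq ?mem_below ?ltnn // => i.
by rewrite inE !mem_below ltnS leq_eqVlt.
Qed.

Lemma perm_top mo L : perm_eq L (below mo) -> perm_eq (mo :: L) (below mo.+1).
Proof. by rewrite (permPr (perm_belowS mo)) perm_cons. Qed.

(** The permutations [s] with a prescribed past: [A] lists the arcs drawn so far,
    and [O] the open sources, whose values are at least [m]. Sorting [O] by these
    values records the upper crossings and nestings met so far without fixing the
    values themselves. *)
Definition compat m A O s :=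
  [&& all (fun p => s p.1 == p.2) A, all (fun o => m <= s o)%N O
    & sorted ltn [seq val (s o) | o <- O]].

Lemma compat_cons m p A O s :
  compat m (p :: A) O s = (s p.1 == p.2) && compat m A O s.
Proof. by rewrite /compat /= -andbA. Qed.

Lemma compat_arc m A O s p : compat m A O s -> p \in A -> s p.1 = p.2.
Proof. by case/and3P=> /allP sA _ _ /sA /eqP. Qed.

Lemma compat_open m A O s o : compat m A O s -> o \in O -> (m <= s o)%N.
Proof. by case/and3P=> _ /allP sO _ /sO. Qed.

(** Either no open source takes the value [mo], or the source that does is the
    head of [O], as [O] is ordered by values and these are at least [mo]. *)
Lemma sum_close (R : nmodType) (f : 'S_n -> R) mo A O :
  \sum_(s | compat mo A O s) f s = \sum_(s | compat mo.+1 A O s) f s +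
    (if O is o :: O' then \sum_(s | compat mo.+1 ((o, mo) :: A) O' s) f s else 0).
Proof.
case: O => [|o O]; first by rewrite addr0.
rewrite (bigID (fun s => s o == mo)) [RHS]addrC /=; congr (_ + _); apply: eq_bigl => s.
  rewrite /compat /= -!andbA; have [eqs|] := eqVneq (s o) mo; rewrite ?andbF //= andbT.
  case: (all _ A) => //=; rewrite eqs leqnn /= path_sortedE; last exact: ltn_trans.
  rewrite all_map andbA; congr (_ && _); rewrite -all_predI; apply: eq_all => x /=; lia.
rewrite /compat /= -!andbA; case: (all _ A) => //=.
rewrite path_sortedE; last exact: ltn_trans.
rewrite [in RHS]ltn_neqAle -(inj_eq val_inj) eq_sym all_map.
case: (boolP (_ == _)) => /= ne; first by rewrite !andbF.
case: leqP => //= les; rewrite andbT.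
have [lt|_] := boolP (all (preim _ _) O); last by rewrite /= !andbF.
rewrite (_ : all (fun o0 => mo <= s o0)%N O); last by apply/allP=> x /(allP lt) /=; lia.
by rewrite (_ : all (fun o0 => mo < s o0)%N O); last by apply/allP=> x /(allP lt) /=; lia.
Qed.

Definition insert_at l (x : 'I_n) L := take l L ++ x :: drop l L.

Lemma perm_insert l x L : perm_eq (insert_at l x L) (x :: L).
Proof. by rewrite /insert_at -cat1s perm_catCA cat_take_drop. Qed.

(** Opening [mo] at place [l] of the order is the same event as [mo] having
    exactly [l] upper crossings with the open sources. *)
Lemma compat_insert mo A O l s : (l <= size O)%N -> mo \notin O ->
  compat mo.+1 A (insert_at l mo O) s =
  [&& compat mo.+1 A O s, (mo < s mo)%N & count (fun o => s o < s mo)%N O == l].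
Proof.
move=> lO moO; rewrite /compat /insert_at.
have -> : sorted ltn [seq val (s o) | o <- take l O ++ mo :: drop l O] =
    sorted ltn [seq val (s o) | o <- O] && (count (fun o => s o < s mo)%N O == l).
  rewrite map_cat map_take map_cons map_drop.
  set S := [seq _ | _ <- _]; have [sS|nsS] := boolP (sorted ltn S).
    rewrite sorted_ins ?size_map ?count_map //.
    by apply: contra moO => /mapP[o oO /val_inj/perm_inj->].
  apply: contraNF nsS => /(subseq_sorted ltn_trans); apply.
  by rewrite -{1}(cat_take_drop l S) cat_subseq // subseq_cons.
rewrite all_cat /= (andbCA (all _ (take l O))) -all_cat cat_take_drop -!andbA.
case: (all _ A) => //=; case: (all _ O) => //=; last by rewrite andbF.
by rewrite andbCA.
Qed.

(** [V] lists the vacant values: those below [m] that no arc of [A] hits. *)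
Definition scanned m A O V :=
  perm_eq (unzip1 A ++ O) (below m) /\ perm_eq (unzip2 A ++ V) (below m).

(** The situation once the fate of the value [mo] is known, but not yet that of
    the source [mo]. The value [mo] is hit by an arc of [A] exactly when it is the
    value of a smaller source; otherwise it is not counted in [V], as the source
    [mo] itself may still take it. *)
Definition half_scanned mo A O V :=
  perm_eq (unzip1 A ++ O) (below mo) /\
  perm_eq (unzip2 A ++ V) (below (mo + (mo \in unzip2 A))).

Section HalfStep.
Local Open Scope nat_scope.
Variables (mo : 'I_n) (A : seq ('I_n * 'I_n)) (O V : seq 'I_n).
Hypothesis H : half_scanned mo A O V.

Lemma half_src i : (i < mo) = (i \in unzip1 A) || (i \in O).
Proof. by case: H => /perm_mem /(_ i); rewrite mem_cat mem_below. Qed.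

Lemma half_open_uniq : uniq O.
Proof. by case: H => /perm_uniq; rewrite below_uniq cat_uniq => /and3P[]. Qed.

Lemma half_val_uniq : uniq V.
Proof. by case: H => _ /perm_uniq; rewrite below_uniq cat_uniq => /and3P[]. Qed.

Lemma half_val_le u : u \in unzip2 A -> u <= mo.
Proof.
case: H => _ /perm_mem /(_ u); rewrite mem_cat mem_below => + uA.
by rewrite uA /=; case: (mo \in _); lia.
Qed.

Lemma mem_half_val u : (u \in V) = (u < mo) && (u \notin unzip2 A).
Proof.
case: H => _ p; have := perm_uniq p; rewrite below_uniq cat_uniq.
case/and3P=> _ /hasPn /(_ u) dj _; have := perm_mem p u; rewrite mem_cat mem_below.
case: (boolP (u \in V)) dj => [uV /(_ isT) /negPf uA|_ _].
  rewrite uA /=; case: (boolP (mo \in _)) => moA; last by lia.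
  have : u != mo by apply: contraFneq uA => ->.
  by rewrite -(inj_eq val_inj) /=; lia.
by rewrite orbF => ->; case: (mo \in _) => /=; lia.
Qed.

Lemma half_top_open : mo \notin O.
Proof. by have := half_src mo; rewrite ltnn orbC; case: (_ \in _). Qed.

Lemma half_size : size A + size O + (mo \in unzip2 A) = size A + size V.
Proof.
case: H => /perm_size + /perm_size; rewrite !size_cat !size_map => -> ->.
by case: (mo \in _); rewrite ?addn0 ?addn1 //= (perm_size (perm_belowS mo)).
Qed.

Variable s : 'S_n.
Hypothesis sC : compat mo.+1 A O s.

Lemma half_image i : i < mo -> (mo < s i) = (i \in O).
Proof.
rewrite half_src => iAO; case: (boolP (i \in O)) iAO => [iO _|_].
  exact: compat_open sC iO.
rewrite orbF => /mapP[p pA ->]; rewrite (compat_arc sC pA) ltnNge half_val_le //.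
exact: map_f.
Qed.

Lemma half_preimage u : u <= mo -> (mo <= (s^-1)%g u) = (u \notin unzip2 A).
Proof.
move=> umo; rewrite leqNgt half_src; congr negb; apply/idP/idP.
  case/orP => [/mapP[p pA e]|/(compat_open sC)]; last by rewrite permKV; lia.
  by have := compat_arc sC pA; rewrite -e permKV => ->; apply: map_f.
case/mapP=> p pA ->; rewrite -(compat_arc sC pA) permK map_f //.
Qed.

Lemma half_ucross : ucross s mo = count (fun o => s o < s mo) O.
Proof.
rewrite ucrossE -card_count ?half_open_uniq //; apply: eq_card => i; rewrite !inE.
have [imo|imo] /= := ltnP i mo; first by rewrite half_image.
by case: (boolP (i \in O)) => // iO; have := half_src i; rewrite iO orbT; lia.
Qed.

Lemma half_unest : mo < s mo -> unest s mo = count (fun o => s mo < s o) O.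
Proof.
move=> up; rewrite unestE -card_count ?half_open_uniq //; apply: eq_card => i; rewrite !inE up /=.
have [imo|imo] /= := ltnP i mo; first by rewrite -half_image //; lia.
by case: (boolP (i \in O)) => // iO; have := half_src i; rewrite iO orbT; lia.
Qed.

Lemma half_lev : lev s mo = size O.
Proof.
rewrite -(count_predT O) -card_count ?half_open_uniq //; apply: eq_card => i; rewrite !inE andbT.
have [imo|imo] /= := ltnP i mo; first by rewrite half_image.
by case: (boolP (i \in O)) => // iO; have := half_src i; rewrite iO orbT; lia.
Qed.

(** The value [s mo] has to be excluded: it is vacant before the source [mo] is
    read, but its preimage is [mo] itself. *)
Lemma half_open_val u : u < mo -> u != s mo -> (mo < (s^-1)%g u) = (u \in V).
Proof.
move=> umo ne; rewrite mem_half_val umo -(half_preimage (ltnW umo)) ltn_neqAle.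
case: eqP => //= e; case/eqP: ne.
by have -> : mo = (s^-1)%g u by [apply: val_inj]; rewrite permKV.
Qed.

Lemma half_lcross : s mo < mo -> lcross s mo = count (fun u => s mo < u) V.
Proof.
move=> dn; rewrite lcrossE -card_count ?half_val_uniq //; apply: eq_card => u; rewrite !inE.
have [su|//] := ltnP (s mo) u; last by rewrite andbF.
have [umo|] /= := ltnP u mo; last by rewrite mem_half_val; lia.
by rewrite half_open_val ?andbT //; apply: contraTneq su => ->; rewrite ltnn.
Qed.

Lemma half_lnest : s mo < mo -> lnest s mo = count (fun u => u < s mo) V.
Proof.
move=> dn; rewrite lnestE -card_count ?half_val_uniq //; apply: eq_card => u; rewrite !inE.
have [us|//] := ltnP u (s mo); last by rewrite andbF.
rewrite dn half_open_val ?andbT //; first exact: ltn_trans us dn.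
by apply: contraTneq us => ->; rewrite ltnn.
Qed.

Lemma half_down : (s mo \in V) = (s mo < mo).
Proof.
rewrite mem_half_val; have [lt|//] := ltnP (s mo) mo.
by rewrite -(half_preimage (ltnW lt)) permK leqnn.
Qed.

End HalfStep.

Lemma sum_fixed (R : nmodType) (f : 'S_n -> R) mo A O :
  \sum_(s | compat mo.+1 A O s && (s mo == mo)) f s =
  \sum_(s | compat mo.+1 ((mo, mo) :: A) O s) f s.
Proof. by apply: eq_bigl => s; rewrite compat_cons andbC. Qed.

Lemma sum_up (R : nmodType) (f : 'S_n -> R) mo A O : mo \notin O ->
  \sum_(s | compat mo.+1 A O s && (mo < s mo)%N) f s =
  \sum_(l < (size O).+1) \sum_(s | compat mo.+1 A (insert_at l mo O) s) f s.
Proof.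
move=> moO; pose rank s := count (fun o => s o < s mo)%N O.
rewrite (partition_big (fun s => inord (rank s) : 'I_(size O).+1) xpredT) //=.
apply: eq_bigr => l _; apply: eq_bigl => s.
rewrite compat_insert ?leq_ord // -andbA; congr [&& _, _ & _].
by rewrite -(inj_eq val_inj) /= inordK // ltnS count_size.
Qed.

Lemma sum_down (R : nmodType) (f : 'S_n -> R) mo A O V : half_scanned mo A O V ->
  \sum_(s | compat mo.+1 A O s && (s mo < mo)%N) f s =
  \sum_(v <- V) \sum_(s | compat mo.+1 ((mo, v) :: A) O s) f s.
Proof.
move=> H; rewrite big_uniq ?(half_val_uniq H) //=.
rewrite (partition_big (fun s => s mo) (mem V)) /=.
  apply: eq_bigr => v vV; apply: eq_bigl => s.
  rewrite [RHS](_ : _ = compat mo.+1 A O s && (s mo == v)).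
    case: (boolP (compat _ _ _ s)) => //= sC; rewrite -(half_down H sC).
    by case: eqP => [->|]; rewrite ?andbF // vV.
  by rewrite compat_cons andbC.
by move=> s /andP[sC]; rewrite (half_down H sC).
Qed.

Section Weights.
Variables (R : comNzRingType) (a b c d : nat -> nat -> R) (e : nat -> R).

Definition weight s i : R :=
  (if cval s i then a (ucross s i) (unest s i) else 1) *
  (if cpeak s i then b (lcross s i) (lnest s i) else 1) *
  (if cdfall s i then c (lcross s i) (lnest s i) else 1) *
  (if cdrise s i then d (ucross s i) (unest s i) else 1) *
  (if fixpt s i then e (lev s i) else 1).

Lemma Qpoly_weight : Qpoly a b c d e n = \sum_s \prod_i weight s i.
Proof.
apply: eq_bigr => s _; rewrite (big_mkcond (cval s)) (big_mkcond (cpeak s)).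
by rewrite (big_mkcond (cdfall s)) (big_mkcond (cdrise s)) (big_mkcond (fixpt s)) -!big_split.
Qed.

Lemma weight_fix s i : s i = i -> weight s i = e (lev s i).
Proof.
move=> si; have si' : (s^-1)%g i = i by rewrite -{1}si permK.
by rewrite /weight /cval /cpeak /cdfall /cdrise /fixpt si si' ltnn eqxx /= !mul1r.
Qed.

Lemma weight_cval s i : (i < (s^-1)%g i)%N -> (i < s i)%N ->
  weight s i = a (ucross s i) (unest s i).
Proof.
rewrite /weight /cval /cpeak /cdfall /cdrise /fixpt -(inj_eq val_inj) /=.
by case: ltngtP => // _ _; case: ltngtP => // _ _; rewrite !mulr1.
Qed.

Lemma weight_cdrise s i : ((s^-1)%g i < i)%N -> (i < s i)%N ->
  weight s i = d (ucross s i) (unest s i).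
Proof.
rewrite /weight /cval /cpeak /cdfall /cdrise /fixpt -(inj_eq val_inj) /=.
by case: ltngtP => // _ _; case: ltngtP => // _ _; rewrite !mul1r mulr1.
Qed.

Lemma weight_cdfall s i : (i < (s^-1)%g i)%N -> (s i < i)%N ->
  weight s i = c (lcross s i) (lnest s i).
Proof.
rewrite /weight /cval /cpeak /cdfall /cdrise /fixpt -(inj_eq val_inj) /=.
by case: ltngtP => // _ _; case: ltngtP => // _ _; rewrite !mul1r !mulr1.
Qed.

Lemma weight_cpeak s i : ((s^-1)%g i < i)%N -> (s i < i)%N ->
  weight s i = b (lcross s i) (lnest s i).
Proof.
rewrite /weight /cval /cpeak /cdfall /cdrise /fixpt -(inj_eq val_inj) /=.
by case: ltngtP => // _ _; case: ltngtP => // _ _; rewrite !mul1r !mulr1.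
Qed.

Definition tail_weight m s : R := \prod_(i : 'I_n | (m <= i)%N) weight s i.

Lemma tail_weightS mo s : tail_weight mo s = weight s mo * tail_weight mo.+1 s.
Proof.
rewrite /tail_weight (bigD1 mo) //=; congr (_ * _); apply: eq_bigl => i.
by rewrite ltn_neqAle andbC -(inj_eq val_inj) eq_sym.
Qed.

(** One step of the downward induction: [M] stands for the total weight of the
    positions above [mo], which depends on the past through the number of open
    sources only. *)
Section Step.
Variables (mo : 'I_n) (M : nat -> R).
Hypothesis IH : forall A O V, scanned mo.+1 A O V ->
  \sum_(s | compat mo.+1 A O s) tail_weight mo.+1 s = M (size O).

Lemma sum_trichotomy A O :
  \sum_(s | compat mo.+1 A O s) tail_weight mo s =
    \sum_(s | compat mo.+1 A O s && (s mo == mo)) tail_weight mo s +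
    \sum_(s | compat mo.+1 A O s && (mo < s mo)%N) tail_weight mo s +
    \sum_(s | compat mo.+1 A O s && (s mo < mo)%N) tail_weight mo s.
Proof.
rewrite (bigID (fun s => s mo == mo)) -addrA; congr (_ + _).
rewrite (bigID (fun s => mo < s mo)%N) /=; congr (_ + _); apply: eq_bigl => s;
  by rewrite -andbA -(inj_eq val_inj); case: ltngtP; rewrite /= ?andbF ?andbT.
Qed.

(** If the source [mo] opens, its place [l] in the order of the open sources is
    free and determines [ucross] and [unest], so the weights add up to a starred
    sum. The vacant values [V'] after [mo] is read differ between a cycle
    valley and a cycle double rise, whence the hypothesis on [V']. *)
Lemma weighted_up (g : nat -> nat -> R) A O V V' : half_scanned mo A O V ->
  perm_eq (unzip2 A ++ V') (below mo.+1) ->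
  (forall s, compat mo.+1 A O s -> (mo < s mo)%N ->
     weight s mo = g (ucross s mo) (unest s mo)) ->
  \sum_(s | compat mo.+1 A O s && (mo < s mo)%N) tail_weight mo s =
  pstar g (size O).+1 * M (size O).+1.
Proof.
move=> H pV' wE; have moO := half_top_open H.
rewrite sum_up // /pstar mulr_suml; apply: eq_bigr => l _.
have lO : (l <= size O)%N by rewrite -ltnS.
transitivity (\sum_(s | compat mo.+1 A (insert_at l mo O) s)
    g l (size O - l)%N * tail_weight mo.+1 s).
  apply: eq_bigr => s; rewrite compat_insert // => /and3P[sC up /eqP rk].
  rewrite tail_weightS wE // (half_ucross H sC) rk (half_unest H sC up).
  congr (g _ _ * _); have := count_predC (fun o => s o < s mo)%N O.
  rewrite rk => szO; rewrite -[X in (X - _)%N]szO addKn; apply: eq_in_count => o oO /=.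
  case: ltngtP => // /val_inj/perm_inj eqo.
  by rewrite eqo oO in moO.
rewrite -mulr_sumr (IH (V := V')).
  by rewrite size_cat /= size_take_min (minn_idPl lO) size_drop addnS subnKC.
split=> //; case: H => /perm_top pO _; rewrite -(permPr pO) perm_sym.
by rewrite (perm_catCA [:: mo] (unzip1 A) O) perm_cat2l perm_sym perm_insert.
Qed.

(** If [mo] takes a smaller value, it is a free choice in [V], and its rank in [V]
    gives [lcross] and [lnest]. *)
Lemma weighted_down (g : nat -> nat -> R) A O V : half_scanned mo A O V ->
  (forall v, v \in V -> exists V', scanned mo.+1 ((mo, v) :: A) O V') ->
  (forall s, compat mo.+1 A O s -> (s mo < mo)%N ->
     weight s mo = g (lcross s mo) (lnest s mo)) ->
  \sum_(s | compat mo.+1 A O s && (s mo < mo)%N) tail_weight mo s =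
  pstar g (size V) * M (size O).
Proof.
move=> H scannedV wE; rewrite (sum_down _ H).
rewrite -(size_map val V) -sum_ranks ?(map_inj_uniq val_inj) ?(half_val_uniq H) //.
rewrite big_map mulr_suml !big_seq; apply: eq_bigr => v vV.
have [V' scanned'] := scannedV v vV; rewrite -(IH scanned') mulr_sumr.
apply: eq_bigr => s; rewrite compat_cons => /andP[/eqP smo sC].
have dn : (s mo < mo)%N by rewrite -(half_down H sC) smo.
rewrite tail_weightS wE // (half_lcross H sC dn) (half_lnest H sC dn) !count_map.
by rewrite smo.
Qed.

(** The value [mo] is not taken by a smaller source: [mo] is a cycle valley, a
    cycle double fall or a fixed point. *)
Lemma open_step A O V : scanned mo A O V ->
  \sum_(s | compat mo.+1 A O s) tail_weight mo s =
  pstar a (size O).+1 * M (size O).+1 + (pstar c (size O) + e (size O)) * M (size O).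
Proof.
case=> pO pV; have /negPf moA : mo \notin unzip2 A.
  by apply/negP=> moA; have := perm_mem pV mo; rewrite mem_cat moA mem_below ltnn.
have H : half_scanned mo A O V by split=> //; rewrite moA addn0.
have szV : size V = size O by apply/eqP; have := half_size H; rewrite moA; lia.
have src s : compat mo.+1 A O s -> (mo <= (s^-1)%g mo)%N.
  by move=> sC; rewrite (half_preimage H sC) ?moA.
have src_lt s : compat mo.+1 A O s -> s mo != mo -> (mo < (s^-1)%g mo)%N.
  move=> sC ne; rewrite ltn_neqAle src // andbT; apply: contra ne => /eqP/val_inj e'.
  by rewrite {1}e' permKV.
have pO' : perm_eq (mo :: unzip1 A ++ O) (below mo.+1) by exact: perm_top.
have pV' : perm_eq (mo :: unzip2 A ++ V) (below mo.+1) by exact: perm_top.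
rewrite sum_trichotomy (@weighted_up a A O V (mo :: V)) //; first last.
- move=> s sC up; apply: weight_cval => //; apply: src_lt => //.
  by rewrite -(inj_eq val_inj) gtn_eqF.
- by rewrite (perm_catCA _ [:: mo]).
rewrite (@weighted_down c A O V) //; first last.
- move=> s sC dn; apply: weight_cdfall => //; apply: src_lt => //.
  by rewrite -(inj_eq val_inj) ltn_eqF.
- move=> v vV; exists (mo :: rem v V); split=> //=.
  rewrite -cat_cons (perm_catCA _ [:: mo]) -(permPr pV') perm_cons.
  by rewrite (perm_catCA [:: v]) perm_cat2l perm_sym perm_to_rem.
rewrite sum_fixed szV addrAC addrC mulrDl; congr (_ + _); rewrite addrC; congr (_ + _).
rewrite -(IH (A := (mo, mo) :: A) (O := O) (V := V)) // mulr_sumr.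
apply: eq_bigr => s; rewrite compat_cons => /andP[/eqP /= smo sC].
by rewrite tail_weightS weight_fix // (half_lev H sC).
Qed.

(** The value [mo] is taken by a smaller source, so that [mo] is a cycle double
    rise or a cycle peak. One open source has just been closed, hence there is one
    vacant value more than there are open sources. *)
Lemma closed_step A o O V : scanned mo A (o :: O) V ->
  \sum_(s | compat mo.+1 ((o, mo) :: A) O s) tail_weight mo s =
  pstar d (size O).+1 * M (size O).+1 + pstar b (size O).+1 * M (size O).
Proof.
case=> pO pV; set A' := (o, mo) :: A.
have pO1 : perm_eq (unzip1 A' ++ O) (below mo).
  by rewrite -(permPr pO) perm_sym (perm_catCA _ [:: o]).
have moA : mo \in unzip2 A' by rewrite inE eqxx.
have pV1 : perm_eq (unzip2 A' ++ V) (below mo.+1) by exact: perm_top.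
have H : half_scanned mo A' O V by split=> //; rewrite moA addn1.
have szV : size V = (size O).+1 by have := half_size H; rewrite moA; lia.
have src s : compat mo.+1 A' O s -> ((s^-1)%g mo < mo)%N.
  by move=> sC; rewrite ltnNge (half_preimage H sC) ?moA.
have pO' : perm_eq (mo :: unzip1 A' ++ O) (below mo.+1) by exact: perm_top.
rewrite sum_trichotomy (@weighted_up d A' O V V) //; last first.
  by move=> s sC up; apply: weight_cdrise => //; apply: src.
rewrite (@weighted_down b A' O V) //; first last.
- by move=> s sC dn; apply: weight_cpeak => //; apply: src.
- move=> v vV; exists (rem v V); split=> //=.
  rewrite -(permPr pV1) (perm_catCA [:: v] (unzip2 A')) perm_cat2l.
  by rewrite perm_sym perm_to_rem.
rewrite big1 ?add0r ?szV // => s /andP[sC /eqP smo].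
by have := src s sC; rewrite -{1}smo permK ltnn.
Qed.

End Step.

(** Independent choices are never contradictory: a complete system of arcs is the
    graph of a permutation. *)
Lemma complete_arcs A : perm_eq (unzip1 A) (below n) -> perm_eq (unzip2 A) (below n) ->
  exists s0, forall s, compat n A [::] s = (s == s0).
Proof.
move=> p1 p2.
have u1 : uniq (unzip1 A) by rewrite (perm_uniq p1) below_uniq.
have u2 : uniq (unzip2 A) by rewrite (perm_uniq p2) below_uniq.
have all1 i : i \in unzip1 A by rewrite (perm_mem p1) mem_below.
pose f i := nth i (unzip2 A) (index i (unzip1 A)).
have szi i : (index i (unzip1 A) < size A)%N by rewrite -(size_map fst) index_mem.
have fA i : (i, f i) \in A.
  rewrite (_ : (i, f i) = nth (i, i) A (index i (unzip1 A))) ?mem_nth //.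
  by rewrite [RHS]surjective_pairing -!(nth_map _ i) // nth_index.
have f_inj : injective f.
  move=> i j; rewrite /f (set_nth_default i) ?size_map // => /eqP.
  by rewrite nth_uniq ?size_map // => /eqP/index_inj->.
exists (perm f_inj) => s; rewrite /compat !andbT; apply/allP/eqP => [sA|-> p pA].
  by apply/permP => i; rewrite permE; apply/eqP/(sA _ (fA i)).
rewrite permE; apply/eqP; set q := index p A.
have qA : (q < size A)%N by rewrite index_mem.
have -> : p = nth p A q by rewrite nth_index.
rewrite -(nth_map p p.1 fst) // -(nth_map p p.2 snd) // /f index_uniq ?size_map //.
by apply: set_nth_default; rewrite size_map.
Qed.

Lemma sum_compat (k : nat) m A O V : (m + k)%N = n -> scanned m A O V ->
  \sum_(s | compat m A O s) tail_weight m s =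
  motzkin (fun h => pstar a h.+1) (fun h => pstar c h + pstar d h + e h)
    (fun h => pstar b h.+1) k (size O).
Proof.
elim: k m A O V => [|k IH] m A O V; rewrite ?addn0 ?addnS => nE scA.
  subst m; rewrite (eq_bigr (fun=> 1)) => [|s _]; last first.
    by rewrite /tail_weight big_pred0 // => i; rewrite leqNgt ltn_ord.
  case: O scA => [|o O] [pO pV] /=; last first.
    by rewrite big_pred0 // => s; rewrite /compat /= leqNgt ltn_ord /= andbF.
  rewrite cats0 in pO; have V0 : V = [::].
    apply: size0nil; move/perm_size: pV; rewrite -(perm_size pO) size_cat !size_map => /eqP.
    by rewrite -[X in _ == X]addn0 eqn_add2l => /eqP.
  rewrite V0 cats0 in pV; have [s0 s0E] := complete_arcs pO pV.
  by rewrite (eq_bigl _ _ s0E) big_pred1_eq.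
have mn : (m < n)%N by lia.
pose mo := Ordinal mn; rewrite -[m]/(val mo) in scA *.
have IHmo A' O' V' : scanned mo.+1 A' O' V' ->
  \sum_(s | compat mo.+1 A' O' s) tail_weight mo.+1 s = _ := IH mo.+1 A' O' V' nE.
rewrite sum_close (open_step IHmo scA) [RHS]/=.
case: O scA => [|o O] scA.
  have d0 : pstar d 0 = 0 by rewrite /pstar big_ord0.
  by rewrite /= d0 !addr0.
by rewrite (closed_step IHmo scA) /=; ring.
Qed.

Theorem Qpoly_motzkin : Qpoly a b c d e n =
  motzkin (fun h => pstar a h.+1) (fun h => pstar c h + pstar d h + e h)
    (fun h => pstar b h.+1) n 0.
Proof.
have below0 : below 0 = [::].
  apply/eqP; rewrite -size_eq0 size_filter -leqn0 leqNgt -has_count.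
  exact/hasPn.
rewrite Qpoly_weight -(@sum_compat n 0 [::] [::] [::]) ?add0n //; last by rewrite /scanned below0.
Qed.
End Weights.
End Scan.

(** * Dyck paths and the S-fraction *)

Section Series.
Variable R : comNzRingType.
Implicit Types (f g : fps R) (alpha : nat -> R).

Lemma fps_mulE f g N n : (n < N)%N ->
  fps_mul f g n = ((\poly_(i < N) f i) * (\poly_(i < N) g i))`_n.
Proof.
move=> nN; rewrite coefM; apply: eq_bigr => i _.
by rewrite !coef_poly (leq_ltn_trans _ nN) ?leq_ord // (leq_ltn_trans (leq_subr _ _) nN).
Qed.

(** Only finitely many coefficients matter, so associativity is inherited from
    polynomials. *)
Lemma fps_mulA f g (h : fps R) : fps_mul f (fps_mul g h) =1 fps_mul (fps_mul f g) h.
Proof.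
move=> n; pose P f := \poly_(i < n.+1) f i : {poly R}.
transitivity ((P f * (P g * P h))`_n).
  rewrite coefM; apply: eq_bigr => i _; rewrite coef_poly ltn_ord.
  by rewrite (@fps_mulE _ _ n.+1) // ltnS leq_subr.
rewrite mulrA coefM; apply: eq_bigr => i _; rewrite coef_poly ltnS leq_subr.
by rewrite (@fps_mulE _ _ n.+1).
Qed.

Lemma sfrac_tail0 alpha m i : sfrac_tail alpha m i 0%N = 1.
Proof.
by case: m => [|m] //; rewrite /= /fps_inv /= big_ord0 subr0.
Qed.

(** The first-return decomposition F = 1 + alpha_i t G F, which is another form of
    F = 1 / (1 - alpha_i t G). *)
Lemma sfrac_tailS alpha m i n :
  sfrac_tail alpha m.+1 i n.+1 =
  alpha i * fps_mul (sfrac_tail alpha m i.+1) (sfrac_tail alpha m.+1 i) n.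
Proof.
rewrite [in RHS]/fps_mul [sfrac_tail _ m.+1 _]/=.
set g := sfrac_tail alpha m i.+1; set f := fps_sub _ _.
have ctg k : fps_mul (fps_ct (alpha i)) g k = if k is k'.+1 then alpha i * g k' else 0.
  rewrite /fps_mul /fps_ct; case: k => [|k].
    by rewrite big_ord1 mulr0n mul0r.
  rewrite big_ord_recl mulr0n mul0r add0r big_ord_recl /= mulr1n subn1 /=.
  by rewrite big1 ?addr0 // => j _; rewrite mulr0n mul0r.
have fE k : f k = (k == 0%N)%:R - if k is k'.+1 then alpha i * g k' else 0.
  by rewrite /f /fps_sub ctg.
have /fps_mulV /(_ n.+1) : f 0%N = 1 by rewrite fE subr0.
rewrite /fps_mul big_ord_recl fE subr0 mul1r /fps_one /= => /eqP.
rewrite addr_eq0 => /eqP ->; rewrite -sumrN mulr_sumr; apply: eq_bigr => j _.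
by rewrite fE /bump /= sub0r mulNr opprK mulrA subSS.
Qed.

Local Arguments sfrac_tail : simpl never.

(** Total weight of the paths with [k] steps up or down from height [h] to height
    0, a descent from height i having weight alpha_i. *)
Fixpoint dyck alpha (k h : nat) : R :=
  match k, h with
  | 0, _ => (h == 0%N)%:R
  | k'.+1, 0 => dyck alpha k' 1
  | k'.+1, h'.+1 => dyck alpha k' h'.+2 + alpha h'.+1 * dyck alpha k' h'
  end.

Lemma dyck_small alpha k h : (k < h)%N -> dyck alpha k h = 0.
Proof.
elim: k h => [|k IH] [|h] //= lt; rewrite !IH ?mulr0 ?addr0 //; lia.
Qed.

(** The product of alpha_h ... alpha_1 by the tails of levels h + 1, ..., 1 of the
    fraction truncated at depth [m]: cutting a path at its first visits of heights
    h - 1, ..., 0 shows that the coefficient of t^n is the weight of the paths from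
    [h] to 0 with n ascents that stay below height m + 1. *)
Fixpoint sfrac_stack alpha m h : fps R :=
  if h is h'.+1 then
    fun n => alpha h * fps_mul (sfrac_tail alpha (m - h) h.+1) (sfrac_stack alpha m h') n
  else sfrac_tail alpha m 1.

Lemma sfrac_tail_mul alpha m i g n :
  fps_mul (sfrac_tail alpha m.+1 i) g n = g n +
    if n is n'.+1 then alpha i * fps_mul (sfrac_tail alpha m i.+1)
        (fps_mul (sfrac_tail alpha m.+1 i) g) n' else 0.
Proof.
rewrite {1}/fps_mul big_ord_recl sfrac_tail0 mul1r subn0; congr (_ + _).
case: n => [|n]; first by rewrite big_ord0.
rewrite fps_mulA {2}/fps_mul mulr_sumr; apply: eq_bigr => j _.
by rewrite lift0 sfrac_tailS subSS mulrA.
Qed.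

Lemma fps_mulZr f g x n : fps_mul f (fun k => x * g k) n = x * fps_mul f g n.
Proof. by rewrite /fps_mul mulr_sumr; apply: eq_bigr => i _; rewrite mulrCA. Qed.

(** The recursion of [dyck] on the first step: substituting the first-return
    decomposition in the top factor either removes this factor (a descent) or puts
    one more factor on the stack (an ascent). *)
Lemma sfrac_stackE alpha m h n : (h < m)%N ->
  sfrac_stack alpha m h n =
    (if n is n'.+1 then sfrac_stack alpha m h.+1 n' else (h == 0%N)%:R) +
    (if h is h'.+1 then alpha h * sfrac_stack alpha m h' n else 0).
Proof.
case: h => [|h] hm.
  rewrite addr0; case: n => [|n]; first by rewrite /= sfrac_tail0.
  by case: m hm => // m _ /=; rewrite sfrac_tailS subn1.
rewrite [LHS]/=.
rewrite -[(m - h.+1)%N]prednK ?subn_gt0 // sfrac_tail_mul mulrDr addrC.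
congr (_ + _); case: n => [|n]; first by rewrite mulr0.
rewrite [RHS]/= fps_mulZr prednK ?subn_gt0 // -subnS.
by rewrite mulrCA.
Qed.

(** A path with [n] ascents from height [h] never exceeds h + n, so that it does
    not feel the truncation. *)
Lemma dyck_stack alpha m h n : (h + n <= m)%N ->
  sfrac_stack alpha m h n = dyck alpha (h + n.*2) h.
Proof.
move: {2}(h + n.*2)%N (erefl (h + n.*2)%N) => k.
elim: k h n => [|k IH] h n eqk hm.
  by have [-> ->] : h = 0%N /\ n = 0%N by [lia]; rewrite /= sfrac_tail0.
have [n0 | n_gt0] := posnP n.
  subst n; case: h eqk hm => [|h] eqk hm; first by lia.
  rewrite addn0 /= in hm *; rewrite /fps_mul big_ord1 sfrac_tail0 mul1r.
  rewrite IH ?(@dyck_small _ h h.+2) /= ?addn0 ?add0r //; lia.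
case: n n_gt0 eqk hm => // n _ eqk hm.
rewrite sfrac_stackE; last by lia.
rewrite IH; [|lia..]; rewrite eqk; have -> : (h.+1 + n.*2 = k)%N by lia.
case: h eqk hm => [|h] eqk hm /=; first by rewrite addr0.
by rewrite IH; [congr (_ + _ * dyck _ _ _); lia|lia..].
Qed.

Theorem dyck_sfrac alpha : is_sfrac alpha (fun n => dyck alpha n.*2 0).
Proof.
by move=> n; exists n => m nm; rewrite -[sfrac_tail _ _ _]/(sfrac_stack alpha m 0) dyck_stack.
Qed.

(** Two consecutive steps of a Dyck path that starts at an even height form one
    step of a Motzkin path. The weights [up] sit on the ascents of a
    Motzkin path but on the descents of a Dyck path. The h descents of a Motzkin
    path that are not paired with an ascent miss such a factor, and the product
    restores these factors. *)
Lemma motzkin_dyck (up level down : nat -> R) alpha :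
  level 0%N = down 0%N ->
  (forall h, level h.+1 = up h + down h.+1) ->
  (forall h, alpha h.*2.+1 = down h) ->
  (forall h, alpha h.*2.+2 = up h) ->
  forall k h, dyck alpha k.*2 h.*2 = (\prod_(j < h) up j) * motzkin up level down k h.
Proof.
move=> lev0 levS odd_ even_; elim=> [|k IH] h.
  by case: h => [|h] /=; rewrite ?big_ord0 ?mulr1 ?mulr0.
have dyckS j i : dyck alpha j.+1 i = dyck alpha j i.+1 +
    (if i is i'.+1 then alpha i * dyck alpha j i' else 0).
  by case: i => [|i] //=; rewrite addr0.
rewrite doubleS !dyckS -doubleS IH.
case: h => [|h].
  have := IH 0%N; rewrite double0 => IH0.
  by rewrite IH0 (odd_ 0%N) big_ord1 big_ord0 /= lev0; ring.
rewrite odd_ {2}doubleS dyckS even_ odd_ -doubleS !IH.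
by rewrite !big_ord_recr /= levS; ring.
Qed.

Theorem Qpoly_sfrac (a b c d : nat -> nat -> R) (e : nat -> R) alpha :
  (forall n, pstar c n + pstar d n + e n = pstar a n + pstar b n.+1) ->
  (forall h, alpha h.*2.+1 = pstar b h.+1) ->
  (forall h, alpha h.*2.+2 = pstar a h.+1) ->
  is_sfrac alpha (Qpoly a b c d e).
Proof.
move=> rel alpha_odd alpha_even n; have [N sN] := dyck_sfrac alpha n.
exists N => m /sN ->; rewrite Qpoly_motzkin.
have := motzkin_dyck (level := fun h => pstar c h + pstar d h + e h) _ _ alpha_odd alpha_even.
move/(_ _ _ n 0%N); rewrite double0 big_ord0 mul1r; apply.
  by rewrite rel /pstar big_ord0 add0r.
by move=> h; rewrite rel.
Qed.
End Series.

(** * Transport to the quotient ring *)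

Lemma Qpoly_rmorph (R S : comNzRingType) (phi : {rmorphism R -> S})
    (a b c d : nat -> nat -> R) (e : nat -> R) n :
  phi (Qpoly a b c d e n) =
  Qpoly (fun l m => phi (a l m)) (fun l m => phi (b l m))
    (fun l m => phi (c l m)) (fun l m => phi (d l m)) (fun l => phi (e l)) n.
Proof.
by rewrite rmorph_sum; apply: eq_bigr => s _; rewrite !rmorphM !rmorph_prod.
Qed.

Lemma relator_ideal n : relator n \in relideal.
Proof.
apply/relidealP; exists n.+1, (fun i => (i == ord_max)%:R).
rewrite (bigD1 ord_max) //= eqxx mul1r big1 ?addr0 // => i /negPf ->.
by rewrite mul0r.
Qed.

Lemma star_relation_rmorph (R S : comNzRingType) (phi : {rmorphism R -> S})
    (a b c d : nat -> nat -> R) (e : nat -> R) n :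
  phi (pstar c n + pstar d n + e n) = phi (pstar a n + pstar b n.+1) ->
  pstar (fun l m => phi (c l m)) n + pstar (fun l m => phi (d l m)) n +
    phi (e n) =
  pstar (fun l m => phi (a l m)) n + pstar (fun l m => phi (b l m)) n.+1.
Proof. by rewrite !rmorphD !raddf_pstar. Qed.

Theorem theorem2p11 (alpha : nat -> Zquot)
  (alpha_odd : forall k : nat, (1 <= k)%N ->
     alpha (2 * k - 1)%N = proj (pstar Xb k))
  (alpha_even : forall k : nat, (1 <= k)%N ->
     alpha (2 * k)%N = proj (pstar Xa k)) :
  is_sfrac alpha (fun n : nat => proj (Qpoly Xa Xb Xc Xd Xe n)).
Proof.
pose phi : {rmorphism Zabcde -> Zquot} := (\pi_Zquot)%qT.
have pstarX := raddf_pstar phi.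
have sfrac : is_sfrac alpha
    (Qpoly (fun l m => proj (Xa l m)) (fun l m => proj (Xb l m))
       (fun l m => proj (Xc l m)) (fun l m => proj (Xd l m))
       (fun l => proj (Xe l))).
  apply: Qpoly_sfrac => [n|h|h].
  - apply: (@star_relation_rmorph _ _ phi Xa Xb Xc Xd Xe n).
    by apply/proj_eqP; apply: relator_ideal.
  - apply: etrans (pstarX Xb h.+1); rewrite -[RHS]alpha_odd //.
    by congr alpha; lia.
  - apply: etrans (pstarX Xa h.+1); rewrite -[RHS]alpha_even //.
    by congr alpha; lia.
move=> n; have [N sN] := sfrac n; exists N => m /sN ->.
by symmetry; apply: (@Qpoly_rmorph _ _ phi Xa Xb Xc Xd Xe n).
Qed.
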